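(* Let $k$ be a positive integer. There exists a number $\psi_k$ with $$\frac{2k-2}{2k-1}\pi \leq \psi_k < \pi$$ such that for every pair of distinct, non-antipodal points $\alpha \neq \beta \in \mathbb{S}^1$: if the length of the arc with endpoints $\alpha,\beta$ is less than $\psi_k$, then the segment $[\mathrm{SM}_{2k}(\alpha), \mathrm{SM}_{2k}(\beta)]$ is an edge of $\mathcal{B}_{2k}$; and if the length of the arc with endpoints $\alpha,\beta$ is greater than $\psi_k$, then $[\mathrm{SM}_{2k}(\alpha), \mathrm{SM}_{2k}(\beta)]$ is not an edge of $\mathcal{B}_{2k}$.
   Context: The symmetric moment curve is $\mathrm{SM}_{2k}:\mathbb{R}\to\mathbb{R}^{2k}$, $\mathrm{SM}_{2k}(t)=(\cos t,\sin t,\cos 3t,\sin 3t,\ldots,\cos(2k-1)t,\sin(2k-1)t)$. It is $2\pi$-periodic, so it is regarded as a map on $\mathbb{S}^1=\mathbb{R}/2\pi\mathbb{Z}$ (identified with the unit circle via $t\mapsto(\cos t,\sin t)$); $t$ and $t+\pi$ are antipodal points. $\mathcal{B}_{2k}=\mathrm{conv}(\mathrm{SM}_{2k}(\mathbb{S}^1))\subset\mathbb{R}^{2k}$. A face of a convex body is its intersection with a supporting hyperplane; an edge is a 1-dimensional face. For distinct non-antipodal $\alpha,\beta\in\mathbb{S}^1$, ''the arc with endpoints $\alpha,\beta$'' means the shorter of the two arcs of $\mathbb{S}^1$ determined by $\alpha$ and $\beta$ (the circle has total length $2\pi$). *)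

(* Defs.v *)
From mathcomp Require Import all_boot all_order all_algebra.
From mathcomp Require Import all_classical all_reals all_analysis.

Set Implicit Arguments.
Unset Strict Implicit.
Unset Printing Implicit Defensive.

Import Order.TTheory GRing.Theory Num.Theory.

Local Open Scope classical_set_scope.
Local Open Scope ring_scope.

Section ConvexGeometry.
Context {R : realType} {n : nat}.
Implicit Types (A B F C : set 'rV[R]_n) (c x y p : 'rV[R]_n).

Definition dot x y : R := \sum_(i < n) x 0 i * y 0 i.

Definition segment x y : set 'rV[R]_n :=
  [set (1 - t) *: x + t *: y | t in `[0, 1]%classic].

Definition conv_hull A : set 'rV[R]_n := smallest (@convex_set R 'rV[R]_n) A.

(* The flat through p directed by the row space of V. *)
Definition flat p (V : 'M[R]_n) : set 'rV[R]_n :=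
  [set x | (x - p <= V)%MS].

Definition affine_hull A : set 'rV[R]_n :=
  smallest [set C | exists p V, C = flat p V] A.

Definition affine_dim A (d : nat) : Prop :=
  exists p (V : 'M[R]_n), \rank V = d /\ affine_hull A = flat p V.

Definition hyperplane c (b : R) : set 'rV[R]_n := [set x | dot c x = b].

Definition supporting_hyperplane B c (b : R) : Prop :=
  [/\ c != 0, (forall x, B x -> dot c x <= b) & B `&` hyperplane c b !=set0].

Definition is_face B F : Prop :=
  exists c b, supporting_hyperplane B c b /\ F = B `&` hyperplane c b.

Definition is_edge B F : Prop := is_face B F /\ affine_dim F 1.

End ConvexGeometry.

(* The circle R / 2 pi Z is handled through real representatives: its points
   are real numbers up to same_point, and everything below only depends on
   the classes (see SM_same_point and arc_length_same_point). *)
Section Circle.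
Context {R : realType}.
Implicit Types a b t : R.

Definition same_point a b : Prop :=
  exists m : int, b = a + m%:~R * (2 * pi).

Definition antipodal a b : Prop := same_point (a + pi) b.

(* Length, in [0, 2 pi[, of the counterclockwise arc from a to b. *)
Definition ccw_length a b : R :=
  (b - a) - (Num.floor ((b - a) / (2 * pi)))%:~R * (2 * pi).

(* The two arcs determined by a and b are the counterclockwise arcs from a to
   b and from b to a. *)
Definition arc_length a b : R := Num.min (ccw_length a b) (ccw_length b a).

(* Coordinates 2 m and 2 m + 1 are cos ((2 m + 1) t) and sin ((2 m + 1) t). *)
Definition SM (k : nat) t : 'rV[R]_(2 * k) :=
  \row_(j < 2 * k)
    let r := (2 * (j %/ 2) + 1)%:R * t in if odd j then sin r else cos r.

Definition Bsym (k : nat) : set 'rV[R]_(2 * k) := conv_hull (range (SM k)).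

Let twopi_gt0 : 0 < 2 * pi :> R.
Proof. by rewrite mulr_gt0 ?pi_gt0. Qed.

Lemma ccw_length_bounds a b : 0 <= ccw_length a b < 2 * pi.
Proof.
have /andP[h1 h2] := floor_itv ((b - a) / (2 * pi)).
rewrite /ccw_length subr_ge0 -ler_pdivlMr // h1 /=.
by rewrite ltrBlDl; move: h2; rewrite ltr_pdivrMr // intrD mulrDl mul1r.
Qed.

Lemma ccw_length_same_point a b : same_point (a + ccw_length a b) b.
Proof.
exists (Num.floor ((b - a) / (2 * pi))).
by rewrite /ccw_length -addrA subrK addrC subrK.
Qed.

Lemma ccw_length_eq a b a' b' :
  same_point a a' -> same_point b b' -> ccw_length a' b' = ccw_length a b.
Proof.
move=> [m ->] [l ->]; rewrite /ccw_length.
have -> : b + l%:~R * (2 * pi) - (a + m%:~R * (2 * pi))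
        = (b - a) + (l - m)%:~R * (2 * pi).
  by rewrite rmorphB /= mulrBl opprD addrACA.
rewrite [X in Num.floor X]mulrDl mulfK ?gt_eqF // floorDrz ?intr_int // intrKfloor.
by rewrite (intrD R (Num.floor _)) [X in _ - X]mulrDl opprD addrACA subrr addr0.
Qed.

Lemma arc_length_same_point a b a' b' :
  same_point a a' -> same_point b b' -> arc_length a' b' = arc_length a b.
Proof.
by move=> ha hb; rewrite /arc_length (ccw_length_eq ha hb) (ccw_length_eq hb ha).
Qed.

Let periodicz (f : R -> R) : periodic f (pi *+ 2) ->
  forall (m : int) t, f (t + m%:~R * (2 * pi)) = f t.
Proof.
move=> pf [m|m] t.
  by rewrite mulr_natl mulr_natl -[RHS](periodicn pf m).
rewrite NegzE rmorphN /= mulNr !mulr_natl.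
by rewrite -(periodicn pf m.+1) subrK.
Qed.

Lemma SM_same_point k a b : same_point a b -> SM k a = SM k b.
Proof.
move=> [m ->]; apply/rowP => j; rewrite !mxE /=.
set q := (_ + 1)%N.
have -> : q%:R * (a + m%:~R * (2 * pi)) = q%:R * a + (q%:Z * m)%:~R * (2 * pi).
  by rewrite mulrDr mulrA rmorphM.
by rewrite !(periodicz (@sinD2pi R)) !(periodicz (@cosD2pi R)).
Qed.

End Circle.

Arguments Bsym : clear implicits.

(* Main.v *)
Require Import Defs.
From mathcomp Require Import all_boot all_order all_algebra.
From mathcomp Require Import all_classical all_reals all_analysis.
From mathcomp Require Import ring lra zify.

(* A face containing SM(m - h) and SM(m + h) is cut out by a combination of the
   cos((2j-1)t), sin((2j-1)t), maximal at m - h and m + h; averaging it with its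
   reflection in m turns it into p(cos(t - m)) with p an odd polynomial of degree
   at most 2k - 1.  Hence the segment is an edge iff some such p attains its
   maximum over [-1, 1] exactly at x = cos h; call such an x a peak.
   - Replacing p(y) by p(s y) with s = x / x' < 1 moves a peak x up to any
     x' in (x, 1), so the lengths of edges form a down-closed set, and psi is
     its supremum (or the lower bound, if that is larger).
   - psi < pi: the maximum c of p bounds the coefficients of p, so that
     c = p(x) <= C c x, and peaks stay away from 0.
   - Lower bound: let P(sin t) = sin(n t), n = 2k - 1, and x1 = sin(pi / 2n), its
     smallest positive maximum point.  At every interior maximum point w,
     P''(w) = - n^2 / (1 - w^2), so P''(x1) P - P'' vanishes at x1 and is positive
     at the other ones; adding a multiple of y P'(y) makes the derivative vanish
     at x1 as well.  Subtracting a small multiple of this polynomial from P leaves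
     x1 as the only maximum point on any [-s, s] with x1 < s < 1, and the dilation
     above then shows that every x in (x1, 1) is a peak. *)

Set Implicit Arguments.
Unset Strict Implicit.
Unset Printing Implicit Defensive.

Import Order.TTheory GRing.Theory Num.Theory.
Import numFieldNormedType.Exports.
Local Open Scope ring_scope.

(** * Odd polynomials *)

(* Odd polynomials of degree at most [2 k - 1]. *)
Definition raked (R : realType) (k : nat) (p : {poly R}) : Prop :=
  forall i, ~~ odd i || (2 * k <= i)%N -> p`_i = 0.

Section Raked.
Context {R : realType}.
Implicit Types (p q : {poly R}) (a x y : R).

Lemma raked_size k p : raked k p -> (size p <= 2 * k)%N.
Proof. by move=> hp; apply/leq_sizeP => i hi; apply: hp; rewrite hi orbT. Qed.

Lemma rakedD k p q : raked k p -> raked k q -> raked k (p + q).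
Proof. by move=> hp hq i hi; rewrite coefD hp ?hq ?addr0. Qed.

Lemma rakedZ k a p : raked k p -> raked k (a *: p).
Proof. by move=> hp i hi; rewrite coefZ hp ?mulr0. Qed.

Lemma rakedB k p q : raked k p -> raked k q -> raked k (p - q).
Proof. by move=> hp hq i hi; rewrite coefB hp ?hq ?subr0. Qed.

Lemma raked_sum k (I : finType) (F : I -> {poly R}) :
  (forall i, raked k (F i)) -> raked k (\sum_i F i).
Proof. by move=> hF i hi; rewrite coef_sum big1 // => j _; rewrite hF. Qed.

Lemma raked_widen k l p : (k <= l)%N -> raked k p -> raked l p.
Proof.
move=> kl hp i /orP[hi|hi]; apply: hp; first by rewrite hi.
by rewrite (leq_trans _ hi) ?orbT // leq_mul2l kl orbT.
Qed.

Lemma rakedX : raked 1 ('X : {poly R}).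
Proof. by move=> [|[|i]] //; rewrite coefX. Qed.

Lemma raked_X2M k p : raked k p -> raked k.+1 ('X^2 * p).
Proof.
move=> hp i hi; rewrite coefXnM; case: ltnP => // i2; apply: hp.
move: hi; rewrite oddB // addbF; case: (odd i) => //=.
by rewrite mulnS leq_subRL.
Qed.

Lemma raked_deriv2 k p : raked k p -> raked k p^`()^`().
Proof.
move=> hp i hi; rewrite !coef_deriv hp ?mul0rn //.
by move: hi; rewrite /= negbK => /orP[->//|h]; rewrite (leq_trans h) ?orbT // leqW.
Qed.

Lemma raked_XMderiv k p : raked k p -> raked k ('X * p^`()).
Proof.
by move=> hp [|i] hi; rewrite coefXM //= coef_deriv hp ?mul0rn.
Qed.

Lemma raked_dilate k p a :
  raked k p -> exists2 q, raked k q & forall x, q.[x] = p.[a * x].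
Proof.
move=> hp; exists (\poly_(i < 2 * k) (p`_i * a ^+ i)).
  move=> i hi; rewrite coef_poly; case: ltnP => // lik.
  by rewrite hp ?mul0r.
move=> x; rewrite horner_poly (horner_coef_wide _ (raked_size hp)).
by apply: eq_bigr => i _; rewrite exprMn mulrA.
Qed.

Lemma raked_horner0 k p : raked k p -> p.[0] = 0.
Proof. by move=> hp; rewrite horner_coef0 hp. Qed.

Lemma raked_hornerN k p x : raked k p -> p.[- x] = - p.[x].
Proof.
move=> hp; rewrite !(horner_coef_wide _ (raked_size hp)) -sumrN.
apply: eq_bigr => i _; case: (boolP (odd i)) => oi.
  by rewrite exprNn -signr_odd oi expr1 mulN1r mulrN.
by rewrite hp ?oi // !mul0r oppr0.
Qed.

(** Common to [cos] ([a = 1]) and [sin] ([a = -1]): going from one odd multiple to the next involves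
    the factor [2 cos (2 t)], which is [a * (4 y^2 - 2)] in both cases. *)
Lemma raked_recurrence (f : nat -> R -> R) (y : R -> R) (a : R) :
    (forall t, f 0%N t = y t) ->
    (forall t, f 1%N t = a * (4 * y t ^+ 3 - 3 * y t)) ->
    (forall j t, f j.+2 t = a * (4 * y t ^+ 2 - 2) * f j.+1 t - f j t) ->
  forall j, exists2 p, raked j.+1 p & forall t, f j t = p.[y t].
Proof.
move=> f0 f1 fS j.
suff [] : (exists2 p, raked j.+1 p & forall t, f j t = p.[y t]) /\
          (exists2 p, raked j.+2 p & forall t, f j.+1 t = p.[y t]) by [].
elim: j => [|j [[p hp fp] [q hq fq]]]; split.
- by exists 'X; [exact: rakedX | move=> t; rewrite f0 hornerX].
- exists (a *: (4 *: ('X^2 * 'X) - 3 *: 'X)).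
    apply: rakedZ; apply: rakedB; apply: rakedZ; last exact: (raked_widen (leqnSn 1) rakedX).
    by apply: raked_X2M; exact: rakedX.
  by move=> t; rewrite f1 !(hornerD, hornerN, hornerZ, hornerM, hornerXn, hornerX); ring.
- by exists q.
- exists (a *: (4 *: ('X^2 * q) - 2 *: q) - p).
    apply: rakedB; last exact: (raked_widen (leqW (leqnSn j.+1)) hp).
    apply: rakedZ; apply: rakedB; apply: rakedZ; last exact: (raked_widen (leqnSn j.+2) hq).
    exact: raked_X2M.
  by move=> t; rewrite fS fp fq !(hornerD, hornerN, hornerZ, hornerM, hornerXn, hornerX); ring.
Qed.

(** * Odd multiples of an angle *)

Lemma cos_add2 (x u : R) :
  cos (x + (u + u)) = (4 * cos u ^+ 2 - 2) * cos x - cos (x - (u + u)).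
Proof.
rewrite (cosB x) !cosD !sinD; ring: (sin2cos2 u).
Qed.

Lemma cosSS (n : nat) (t : R) :
  cos (n.+4%:R * t) = (4 * cos t ^+ 2 - 2) * cos (n.+2%:R * t) - cos (n%:R * t).
Proof.
have -> : n.+4%:R * t = n.+2%:R * t + (t + t) :> R by rewrite -!natr1; ring.
by rewrite cos_add2; congr (_ - cos _); rewrite -!natr1; ring.
Qed.

Lemma sinSS (n : nat) (t : R) :
  sin (n.+4%:R * t) = (2 - 4 * sin t ^+ 2) * sin (n.+2%:R * t) - sin (n%:R * t).
Proof.
have -> : n.+4%:R * t = n.+2%:R * t + t + t :> R by rewrite -!natr1; ring.
have -> : n%:R * t = n.+2%:R * t - t - t :> R by rewrite -!natr1; ring.
by rewrite !(cosB, cosD, sinB, sinD); ring: (cos2sin2 t).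
Qed.

Lemma cos_raked j :
  exists2 p : {poly R}, raked j.+1 p & forall t, cos ((2 * j + 1)%:R * t) = p.[cos t].
Proof.
apply: (@raked_recurrence (fun j t => cos ((2 * j + 1)%:R * t)) cos 1) => [t|t|i t].
- by rewrite mul1r.
- have -> : (2 * 1 + 1)%:R * t = t + t + t by rewrite natrD natrM; ring.
  by rewrite !cosD sinD; ring: (sin2cos2 t).
- by rewrite mul1r !mulnS -!addnA !add2n cosSS.
Qed.

Lemma sin_raked j :
  exists2 p : {poly R}, raked j.+1 p & forall t, sin ((2 * j + 1)%:R * t) = p.[sin t].
Proof.
apply: (@raked_recurrence (fun j t => sin ((2 * j + 1)%:R * t)) sin (-1)) => [t|t|i t].
- by rewrite mul1r.
- have -> : (2 * 1 + 1)%:R * t = t + t + t by rewrite natrD natrM; ring.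
  by rewrite !sinD cosD; ring: (cos2sin2 t).
- by rewrite !mulnS -!addnA !add2n sinSS; ring.
Qed.

(** Interpolation at the nodes [j / N]: the inverse Vandermonde matrix recovers the coefficients
    from the values, and the sum of the moduli of its entries serves as [C]. *)
Lemma raked_coef_bound N : exists2 C : R, 0 <= C &
  forall p c, (size p <= N)%N -> (forall x, 0 <= x <= 1 -> `|p.[x]| <= c) ->
  forall i, (i < N)%N -> `|p`_i| <= C * c.
Proof.
pose a : 'rV[R]_N := \row_j (j%:R / N%:R).
pose V := Vandermonde N a.
have Vu : V \in unitmx.
  rewrite unitmxE det_Vandermonde unitfE; apply/prodf_neq0 => i _.
  apply/prodf_neq0 => j ij; rewrite !mxE -mulrBl mulf_neq0 ?invr_eq0 //.
    by rewrite subr_eq0 eqr_nat gtn_eqF.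
  by rewrite pnatr_eq0 -lt0n (leq_ltn_trans _ (ltn_ord i)).
exists (\sum_i \sum_j `|invmx V j i|); first by do 2!apply: sumr_ge0 => ? _.
move=> p c sp pc i iN; pose u : 'rV[R]_N := \row_i p`_i.
pose v : 'rV[R]_N := \row_j p.[a 0 j].
have uV : u *m V = v.
  apply/rowP => j; rewrite !mxE (horner_coef_wide _ sp).
  by apply: eq_bigr => l _; rewrite !mxE.
have -> : p`_i = (v *m invmx V) 0 (Ordinal iN) by rewrite -uV mulmxK // mxE.
have v_le j : `|v 0 j| <= c.
  rewrite mxE; apply: pc; rewrite mxE divr_ge0 //=.
  have N0 : (0 < N)%N := leq_ltn_trans (leq0n _) iN.
  by rewrite ler_pdivrMr ?ltr0n // mul1r ler_nat ltnW.
have c0 : 0 <= c by apply: le_trans (v_le (Ordinal iN)).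
rewrite mxE (le_trans (ler_norm_sum _ _ _)) //.
apply: (@le_trans _ _ ((\sum_j `|invmx V j (Ordinal iN)|) * c)); last first.
  rewrite ler_wpM2r // [leRHS](bigD1 (Ordinal iN)) //= lerDl.
  by do 2!apply: sumr_ge0 => ? _.
rewrite mulr_suml; apply: ler_sum => j _.
by rewrite normrM mulrC ler_wpM2l.
Qed.

End Raked.

(** * Peaks *)

Definition peak (R : realType) (k : nat) (x : R) : Prop :=
  exists (p : {poly R}) (c : R), [/\ raked k p,
    (forall y, -1 <= y <= 1 -> p.[y] <= c), p.[x] = c &
    (forall y, -1 <= y <= 1 -> p.[y] = c -> y = x)].

Section Peaks.
Context {R : realType}.
Implicit Types (p q : {poly R}) (x y : R).

(** Scaling by [x / x'] sends [x'] to [x] and shrinks [-1, 1], so [p] has to be controlled on the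
    smaller interval only. *)
Lemma peak_dilate k p (c x x' : R) : 0 < x -> x <= x' -> raked k p ->
    (forall y, `|y| <= x / x' -> p.[y] <= c) -> p.[x] = c ->
    (forall y, `|y| <= x / x' -> p.[y] = c -> y = x) ->
  peak k x'.
Proof.
move=> x0 xx' hp pc px pu; have x'0 : 0 < x' by apply: lt_le_trans xx'.
have s0 : 0 < x / x' by rewrite divr_gt0.
have [q hq qE] := raked_dilate (x / x') hp.
have le_s y : -1 <= y <= 1 -> `|x / x' * y| <= x / x'.
  by rewrite -ler_norml normrM (gtr0_norm s0) ger_pMr.
exists q, c; split => // [y hy|| y hy]; rewrite qE.
- exact/pc/le_s.
- by rewrite divfK ?gt_eqF.
- move=> /(pu _ (le_s _ hy)) h; apply: (mulfI (lt0r_neq0 s0)).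
  by rewrite h divfK ?gt_eqF.
Qed.

Lemma peak_up k x x' : 0 < x -> x <= x' -> peak k x -> peak k x'.
Proof.
move=> x0 xx' [p [c [hp pc px pu]]].
have x'0 : 0 < x' by apply: lt_le_trans xx'.
have h y : `|y| <= x / x' -> -1 <= y <= 1.
  by rewrite -ler_norml => /le_trans; apply; rewrite ler_pdivrMr ?mul1r.
by apply: (@peak_dilate k p c x x') => // y /h; [exact: pc | exact: pu].
Qed.

Lemma peak_lower_bound k : exists2 x0 : R, 0 < x0 < 1 &
  forall x, 0 < x < 1 -> peak k x -> x0 <= x.
Proof.
have [C C0 hC] := raked_coef_bound (R := R) (2 * k).
(* The summand 2 keeps [D^-1] strictly between 0 and 1. *)
pose D := (2 * k)%:R * C + 2 : R.
have D2 : 2 <= D by rewrite lerDr mulr_ge0.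
have D0 : 0 < D by lra.
exists D^-1; first by rewrite invr_gt0 D0 invf_lt1 //; lra.
move=> x /andP[x0 x1] [p [c [hp pc px pu]]].
have p_le y : 0 <= y <= 1 -> `|p.[y]| <= c.
  move=> /andP[y0 y1]; rewrite ler_norml pc ?andbT; last by lra.
  by rewrite lerNl -(raked_hornerN _ hp) pc //; lra.
have c0 : 0 < c.
  rewrite lt_neqAle (le_trans (normr_ge0 _) (p_le 0 _)) ?lexx ?ler01 // andbT.
  (* Since [p] vanishes at 0, [c = 0] would make 0 a maximum point. *)
  apply/eqP => c0; suff : 0 = x by lra.
  by apply: pu; [lra | rewrite (raked_horner0 hp)].
have : c <= (2 * k)%:R * C * c * x.
  rewrite -{1}px (horner_coef_wide _ (raked_size hp)).
  have -> : (2 * k)%:R * C * c * x = \sum_(i < 2 * k) (C * c * x).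
    by rewrite sumr_const card_ord -[RHS]mulr_natl !mulrA.
  (* The constant term vanishes, and higher powers of [x] are at most [x]. *)
  apply: ler_sum => -[[|i] iN] _ /=.
    by rewrite hp // mul0r !mulr_ge0 // ltW.
  apply: (le_trans (ler_norm _)); rewrite normrM ler_pM //.
    exact: (hC p c (raked_size hp) p_le).
  rewrite ger0_norm ?exprn_ge0 ?(ltW x0) // exprS ler_piMr ?(ltW x0) //.
  by rewrite exprn_ile1 // ltW.
rewrite -{1}[c]mul1r mulrAC ler_pM2r // => h.
rewrite -[leLHS]mul1r ler_pdivrMr // (le_trans h) //.
by rewrite mulrC ler_wpM2l ?(ltW x0) // lerDl.
Qed.

Lemma continuous_horner_within (p : {poly R}) (A : set R) :
  {within A, continuous (horner p)}%classic.
Proof. by apply: continuous_subspaceT => x; exact: continuous_horner. Qed.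

(** Near the zeros of [W] the term [rho] is positive; elsewhere [W] absorbs a small multiple of it.
    Compactness makes [e] uniform. *)
Lemma poly_perturb_gt0 (W rho : {poly R}) (a b : R) : a <= b ->
    (forall x, a <= x <= b -> 0 <= W.[x]) ->
    (forall x, a <= x <= b -> W.[x] = 0 -> 0 < rho.[x]) ->
  exists2 e, 0 < e & forall x, a <= x <= b -> 0 < W.[x] + e * rho.[x].
Proof.
move=> ab W0 rho0.
(* Where [rho <= 0], [W] is at least the minimum of the positive function [f]. *)
pose f x := Num.max W.[x] rho.[x].
have fc : {within `[a, b], continuous f}%classic.
  apply: continuous_subspaceT => x.
  by apply: continuous_max; exact: continuous_horner.
have [z zab fz] := EVT_min ab fc.
have m0 : 0 < f z.
  move: zab; rewrite in_itv /= => zab.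
  rewrite lt_max; have := W0 _ zab; rewrite le_eqVlt => /orP[/eqP h|->//].
  by rewrite rho0 ?orbT.
have [z' z'ab rz'] := EVT_min ab (@continuous_horner_within rho _).
(* [M] exceeds [- rho] on the whole interval, so with the factor [f z / M] the loss stays below
   [f z]. *)
pose M := `|rho.[z']| + 1.
have M0 : 0 < M by rewrite ltr_wpDl.
exists (f z / M); first by rewrite divr_gt0.
move=> x xab; case: (ltP 0 rho.[x]) => rx.
  by rewrite ltr_wpDl ?W0 // mulr_gt0 // divr_gt0.
have Wx : f z <= W.[x].
  have := fz x; rewrite in_itv /= => /(_ xab).
  rewrite /f le_max => /orP[//|h]; move: m0; rewrite ltNge => /negP[].
  exact: le_trans h rx.
have rM : - M < rho.[x].
  have := rz' x; rewrite in_itv /= => /(_ xab); apply: lt_le_trans.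
  by rewrite ltrNl /M ltr_pwDr // -normrN ler_norm.
have : f z / M * - M < f z / M * rho.[x] by rewrite ltr_pM2l // divr_gt0.
by rewrite mulrN divfK ?gt_eqF //; lra.
Qed.

(** The second derivative gives the value at [x] of the quotient by the square. *)
Lemma double_root p x : p.[x] = 0 -> p^`().[x] = 0 ->
  exists2 q, p = ('X - x%:P) ^+ 2 * q & p^`()^`().[x] = 2 * q.[x].
Proof.
move=> /eqP /factor_theorem[q ->]; rewrite derivM derivXsubC !hornerE subrr.
rewrite mulr0 add0r => /eqP /factor_theorem[r ->]; exists r.
  by rewrite -mulrA -expr2 mulrC.
rewrite !(derivXsubC, mulr1, derivM, derivD).
by rewrite !(hornerXsubC, hornerD, hornerM, hornerC) subrr; ring.
Qed.

End Peaks.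

(** * Peaks from Chebyshev polynomials *)

Section Chebyshev.
Context {R : realType}.
Implicit Types (p q : {poly R}) (x y : R).

Section Equation.
Variables (n : R) (P : {poly R}).
Hypothesis P_sin : forall t, P.[sin t] = sin (n * t).

Lemma sin_poly_deriv t : P^`().[sin t] * cos t = n * cos (n * t).
Proof.
have h1 : is_derive t 1 (horner P \o sin) (P^`().[sin t] * cos t).
  exact: is_derive1_comp.
have h2 : is_derive t 1 (fun u => sin (n * u)) (cos (n * t) * n).
  apply: (@is_derive1_comp R sin ( *%R n)).
  by rewrite -[X in is_derive _ _ _ X]mulr1; exact: is_deriveZ.
rewrite [RHS]mulrC -(@derive_val _ _ _ _ _ _ _ h1) -(@derive_val _ _ _ _ _ _ _ h2).
by congr ('D_1 _ t); apply/funext => u /=.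
Qed.

(** Chebyshev's equation [(1 - x^2) P'' - x P' + n^2 P = 0] at [x = sin t], from differentiating
    [P (sin t) = sin (n t)] twice. *)
Lemma sin_poly_deriv2 t :
  P^`()^`().[sin t] * cos t ^+ 2 - P^`().[sin t] * sin t = - n ^+ 2 * sin (n * t).
Proof.
have h0 : is_derive t 1 (horner P^`() \o sin) (P^`()^`().[sin t] * cos t).
  exact: is_derive1_comp.
have h1 := is_deriveM h0 (is_derive_cos t).
have h2 : is_derive t 1 (fun u => n * cos (n * u)) (n * (- sin (n * t) * n)).
  apply: is_deriveZ; apply: (@is_derive1_comp R cos ( *%R n)).
  by rewrite -[X in is_derive _ _ _ X]mulr1; exact: is_deriveZ.
have -> : - n ^+ 2 * sin (n * t) = n * (- sin (n * t) * n) by ring.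
rewrite -(@derive_val _ _ _ _ _ _ _ h2).
have -> : (fun u => n * cos (n * u)) = (horner P^`() \o sin) * cos.
  by apply/funext => u /=; rewrite -sin_poly_deriv.
by rewrite (@derive_val _ _ _ _ _ _ _ h1) /= /GRing.scale /=; ring.
Qed.

Lemma sin_poly_le1 x : -1 <= x <= 1 -> P.[x] <= 1.
Proof. by move=> x1; rewrite -(asinK x1) P_sin sin_le1. Qed.

Hypothesis n_ge1 : 1 <= n.

(* [pi / 2 / n] is the smallest positive [t] with [sin (n t) = 1]. *)
Lemma sin_poly_touch x : -1 < x < 1 -> P.[x] = 1 ->
  [/\ P^`().[x] = 0, P^`()^`().[x] = - n ^+ 2 / (1 - x ^+ 2) &
      x = sin (pi / 2 / n) \/ sin (pi / 2 / n) ^+ 2 < x ^+ 2].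
Proof.
move=> /andP[xN1 x1] Px1; have x11 : -1 <= x <= 1 by rewrite !ltW.
pose t := asin x; have xE : sin t = x by exact: asinK.
have tN : - (pi / 2) < t by rewrite asin_gtNpi2 // xN1 ltW.
have tp : t < pi / 2 by rewrite asin_ltpi2 // x1 ltW.
have ct : 0 < cos t by rewrite cos_gt0_pihalf // tN.
have snt : sin (n * t) = 1 by rewrite -P_sin xE.
have cnt : cos (n * t) = 0 by apply: sin1cos0; rewrite snt normr1.
have P'0 : P^`().[x] = 0.
  have := sin_poly_deriv t; rewrite cnt mulr0 xE => /eqP.
  by rewrite mulf_eq0 (gt_eqF ct) orbF => /eqP.
have n0 : 0 < n := lt_le_trans ltr01 n_ge1.
split => //.
  have := sin_poly_deriv2 t; rewrite snt xE P'0 mul0r subr0 mulr1 cos2sin2 xE.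
  by move=> <-; rewrite mulfK // -xE -cos2sin2 expf_neq0 // gt_eqF.
set t1 := pi / 2 / n; have t10 : 0 < t1 by rewrite !divr_gt0 // pi_gt0.
have t1p : t1 <= pi / 2 by rewrite ler_pdivrMr // ler_peMr // divr_ge0 // pi_ge0.
have st1 : 0 <= sin t1.
  by rewrite sin_ge0_pi // ltW //=; have := pi_gt0 R; lra.
(* In the remaining case [|t| <= t1], so [n * t] lies in [-pi/2, pi/2], where [sin] is injective and
   equals 1 only at [pi / 2]. *)
case: (ltP (sin t1 ^+ 2) (x ^+ 2)) => [|xt1]; [by right | left].
have : `|x| <= sin t1.
  by rewrite -(ger0_norm st1) -ler_sqr ?nnegrE // !real_normK // num_real.
rewrite -xE ler_norml -sinN => /andP[h1 h2].
have tt1 : t <= t1.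
  by move: h2; rewrite leNgt ltr_sin ?in_itv //= -?leNgt //; lra.
have t1t : - t1 <= t.
  by move: h1; rewrite leNgt ltr_sin ?in_itv //= -?leNgt //; lra.
have ntp : n * t <= pi / 2 by rewrite mulrC -ler_pdivlMr.
have ntN : - (pi / 2) <= n * t by rewrite lerNl -mulrN mulrC -ler_pdivlMr // lerNl.
suff -> : t = t1 by [].
apply: (mulfI (lt0r_neq0 n0)); rewrite /t1 mulrC [RHS]mulrC divfK ?gt_eqF // mulrC.
apply: (@sin_inj R); rewrite ?in_itv /= ?ntp ?ntN ?lexx ?andbT //.
  by have := pi_gt0 R; lra.
by rewrite snt sin_pihalf.
Qed.

End Equation.

Lemma peak_above_chebyshev j x :
  sin (pi / 2 / (2 * j + 1)%:R) < x -> x < 1 -> peak j.+1 x.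
Proof.
set n : R := (2 * j + 1)%:R; set x1 := sin _ => x1x x_lt1.
have n1 : 1 <= n by rewrite ler1n addn1.
have n0 : 0 < n := lt_le_trans ltr01 n1.
have [P hP sinP] := @sin_raked R j.
have P_sin t : P.[sin t] = sin (n * t) by rewrite -sinP.
have x10 : 0 < x1.
  apply: sin_gt0_pi; rewrite !divr_gt0 ?pi_gt0 //= ltr_pdivrMr //.
  by have := pi_gt0 R; nra.
have x11 : -1 < x1 < 1 by lra.
have x0 : 0 < x by lra.
have Px1 : P.[x1] = 1.
  by rewrite P_sin mulrC divfK ?gt_eqF // sin_pihalf.
have touch := sin_poly_touch P_sin n1.
have [P'x1 P''x1 _] := touch _ x11 Px1.
set P2 := P^`()^`().[x1] in P''x1.
have P20 : P2 < 0.
  rewrite P''x1 mulNr oppr_lt0 divr_gt0 ?exprn_gt0 //.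
  by nra.
(* Solves [r'(x1) = 0]: as [P'(x1) = 0], this derivative is [- P'''(x1) + C * x1 * P2]. *)
pose C := P^`()^`()^`().[x1] / (x1 * P2).
pose r := P2 *: P - P^`()^`() + C *: ('X * P^`()).
have hr : raked j.+1 r.
  apply: rakedD; last exact/rakedZ/raked_XMderiv.
  by apply: rakedB; [exact: rakedZ | exact: raked_deriv2].
have hE := (hornerD, hornerN, hornerZ, hornerM, hornerX, hornerC).
(* [1 - P] has a double zero at [x1], and [P2 < 0] makes the quotient [W] positive there. *)
have [W WE W2] : exists2 W, 1 - P = ('X - x1%:P) ^+ 2 * W & - P2 = 2 * W.[x1].
  have [||W WE W2] := @double_root R (1 - P) x1.
  - by rewrite !hE Px1 subrr.
  - by rewrite derivB derivC !hE P'x1 oppr0 add0r.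
  exists W => //; rewrite -W2 !(derivB, derivC, deriv0).
  by rewrite !hE add0r.
have [rho rE _] : exists2 rho, r = ('X - x1%:P) ^+ 2 * rho &
    r^`()^`().[x1] = 2 * rho.[x1].
  apply: double_root; first by rewrite /r !hE Px1 P'x1 -/P2; ring.
  rewrite /r !(derivD, derivN, derivZ, derivM, derivX, mul1r) !hE P'x1 -/P2 /C.
  by field; rewrite lt_eqF // gt_eqF.
(* The ratio of the final dilation; [s < 1] makes the maximum points of [P] in [-s, s] interior. *)
pose s := x1 / x; have s0 : 0 < s by rewrite divr_gt0.
have s1 : s < 1 by rewrite ltr_pdivrMr // mul1r.
have WP y : (y - x1) ^+ 2 * W.[y] = 1 - P.[y].
  by have := congr1 (horner^~ y) WE; rewrite !(hE, horner_exp).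
have rP y : (y - x1) ^+ 2 * rho.[y] = r.[y].
  by have := congr1 (horner^~ y) rE; rewrite !(hE, horner_exp).
have Wx1 : 0 < W.[x1] by lra.
have sq_gt0 y : y != x1 -> 0 < (y - x1) ^+ 2.
  by move=> yx1; rewrite exprn_even_gt0 //= subr_eq0.
have [|y /andP[yN ys]|y /andP[yN ys] Wy|e e0 He] :=
    @poly_perturb_gt0 R W rho (- s) s; first by lra.
- have [->|yx1] := eqVneq y x1; first exact: ltW.
  rewrite -(pmulr_rge0 _ (sq_gt0 _ yx1)) WP subr_ge0.
  by apply: (sin_poly_le1 P_sin); lra.
- have yx1 : y != x1 by apply: contraTneq Wx1 => <-; rewrite Wy ltxx.
  have Py : P.[y] = 1 by have := WP y; rewrite Wy mulr0; lra.
  have y11 : -1 < y < 1 by lra.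
  (* Here [r.[y] = P2 - P''(y)], positive because [n^2 / (1 - y^2)] grows with [y^2] and
     [x1^2 < y^2]. *)
  have [P'y P''y []] := touch _ y11 Py; first by move/eqP: yx1.
  rewrite -(pmulr_rgt0 _ (sq_gt0 _ yx1)) rP /r !hE Py P'y P''y P''x1 -/x1 => x1y.
  rewrite !mulr0 mulr1 addr0 !mulNr opprK addrC subr_gt0.
  rewrite ltr_pM2l ?exprn_gt0 // ltf_pV2 ?posrE ?subr_gt0; [|nra..].
  by rewrite ltrD2l ltrN2.
(* On [-s, s] the second factor is positive, so [x1] is the only maximum point of [P - e *: r]
   there. *)
have QE y : 1 - (P - e *: r).[y] = (y - x1) ^+ 2 * (W.[y] + e * rho.[y]).
  by rewrite mulrDr WP mulrCA rP !hE; ring.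
apply: (@peak_dilate R j.+1 (P - e *: r) 1 x1 x) => //; first exact: ltW.
- by apply: rakedB => //; exact: rakedZ.
- move=> y; rewrite ler_norml => /He /ltW h; rewrite -subr_ge0 QE.
  by rewrite mulr_ge0 ?sqr_ge0.
- by apply/eqP; rewrite eq_sym -subr_eq0 QE subrr expr0n mul0r.
- move=> y; rewrite ler_norml => /He h Q1; apply/eqP.
  rewrite -subr_eq0 -sqrf_eq0; apply/eqP.
  have := QE y; rewrite Q1 subrr => /esym/eqP.
  by rewrite mulf_eq0 (gt_eqF h) orbF => /eqP.
Qed.

End Chebyshev.

(** * Faces of convex hulls *)

Section Faces.
Context {R : realType} {n : nat}.
Implicit Types (A : set 'rV[R]_n) (c x y z : 'rV[R]_n).

Lemma dotDl c c' x : dot (c + c') x = dot c x + dot c' x.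
Proof. by rewrite -big_split; apply: eq_bigr => i _; rewrite mxE mulrDl. Qed.

Lemma dotZl a c x : dot (a *: c) x = a * dot c x.
Proof. by rewrite mulr_sumr; apply: eq_bigr => i _; rewrite mxE mulrA. Qed.

Lemma dot_combination c x y a b : dot c (a *: x + b *: y) = a * dot c x + b * dot c y.
Proof.
rewrite !mulr_sumr -big_split; apply: eq_bigr => i _.
by rewrite !mxE mulrDr !(mulrCA (c 0 i)).
Qed.

Lemma segmentC x y : segment x y = segment y x.
Proof.
by apply/seteqP; split=> _ [t t01 <-]; exists (1 - t); rewrite /= ?in_itv /= in t01 *;
  [lra | rewrite subKr addrC | lra | rewrite subKr addrC].
Qed.

Lemma segment_left x y : segment x y x.
Proof. by exists 0; [rewrite /= in_itv /= lexx ler01 | rewrite subr0 scale1r scale0r addr0]. Qed.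

Lemma segment_right x y : segment x y y.
Proof. by rewrite segmentC; exact: segment_left. Qed.

Lemma segment_combination x y z z' a : 0 <= a <= 1 ->
  segment x y z -> segment x y z' -> segment x y (a *: z + (1 - a) *: z').
Proof.
move=> a01 [t + <-] [t' + <-]; rewrite /= !in_itv /= => t01 t'01.
exists (a * t + (1 - a) * t'); first by rewrite /= in_itv /=; nra.
by rewrite !scalerDr !scalerA addrACA -!scalerDl; congr (_ *: _ + _ *: _); ring.
Qed.

Lemma sub_conv_hull A : (A `<=` conv_hull A)%classic.
Proof. exact: sub_gen_smallest. Qed.

Lemma segment_sub_conv_hull A x y : A x -> A y -> (segment x y `<=` conv_hull A)%classic.
Proof.
move=> Ax Ay _ [t + <-] C [convC AC]; rewrite /= in_itv /= => /andP[t0 t1].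
have Cx := mem_set (AC _ Ax); have Cy := mem_set (AC _ Ay).
have /set_mem := convC y x (Itv01 t0 t1) Cy Cx.
by rewrite addrC.
Qed.

(** Lets a face of the hull be checked on the generating set alone. *)
Lemma conv_hull_face A c b x y :
    (forall z, A z -> dot c z <= b) -> A x -> A y -> dot c x = b -> dot c y = b ->
    (forall z, A z -> dot c z = b -> z = x \/ z = y) ->
  (forall z, conv_hull A z -> dot c z <= b) /\
  segment x y = (conv_hull A `&` hyperplane c b)%classic.
Proof.
move=> Ab Ax Ay xb yb Axy.
have segb z : segment x y z -> dot c z = b.
  by move=> [t _ <-]; rewrite dot_combination xb yb -mulrDl subrK mul1r.
(* [C] is a convex set containing [A] that meets the hyperplane in the segment. *)
pose C : set 'rV[R]_n := [set z | dot c z < b \/ segment x y z]%classic.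
have Cle z : C z -> dot c z <= b by case=> [/ltW|/segb ->].
have AC : (conv_hull A `<=` C)%classic.
  apply: smallest_sub => [|z Az].
    (* The weights are strictly between 0 and 1, so one point strictly below the hyperplane pulls
       the mean strictly below it. *)
    apply/convex_setW => z z' /set_mem Cz /set_mem Cz' k k0 k1; apply/mem_set.
    have k01 : 0 <= k%:num <= 1 by rewrite !ltW.
    have lt_avg (u v : R) : u < b -> v <= b -> k%:num * u + (1 - k%:num) * v < b.
      by move=> ub vb; nra.
    have lt_avg' (u v : R) : u <= b -> v < b -> k%:num * u + (1 - k%:num) * v < b.
      by move=> ub vb; nra.
    have [/= zb|zs] := Cz.
      by left; rewrite /= dot_combination lt_avg // Cle.
    have [/= zb'|zs'] := Cz'.
      by left; rewrite /= dot_combination lt_avg' // Cle.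
    by right; exact: (segment_combination k01 zs zs').
  have := Ab _ Az; rewrite le_eqVlt => /orP[/eqP/(Axy _ Az)|zb]; last by left.
  by case=> ->; right; [exact: segment_left | exact: segment_right].
split=> [z /AC/Cle//|]; apply/seteqP; split=> [z zs|z [/AC]].
  by split; [exact: segment_sub_conv_hull zs | exact: segb].
by case=> // + h; rewrite h ltxx.
Qed.

Lemma affine_dim_segment x y : x != y -> affine_dim (segment x y) 1.
Proof.
move=> xy; exists x, <<y - x>>%MS; split.
  by rewrite genmxE rank_rV subr_eq0 eq_sym xy.
apply/seteqP; split.
  apply: smallest_sub => [|_ [t _ <-]]; first by exists x, <<y - x>>%MS.
  rewrite /flat /= genmxE.
  have -> : (1 - t) *: x + t *: y - x = t *: (y - x).
    by rewrite scalerBl scale1r scalerBr addrAC [x - t *: x]addrC addrK addrC.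
  exact: scalemx_sub.
move=> z zx _ [[p [V ->]] seg].
(* A flat containing both endpoints contains the line through them. *)
have xV : (x - p <= V)%MS := seg _ (segment_left x y).
have yV : (y - p <= V)%MS := seg _ (segment_right x y).
rewrite /flat /= -(subrK x z) -addrA addmx_sub //.
apply: (submx_trans zx); rewrite genmxE.
by rewrite -(subrK p y) -addrA addmx_sub // -opprB eqmx_opp.
Qed.

End Faces.

(** * Edges of the symmetric moment curve *)

Section Edges.
Context {R : realType}.
Implicit Types (p q : {poly R}) (m h s t : R).

(** Each coordinate is a polynomial in [cos t] or in [sin t], so no multiple of [2 * pi] has to be
    exhibited. *)
Lemma SM_ext k s t : cos s = cos t -> sin s = sin t -> SM k s = SM k t.
Proof.
move=> cst sst; apply/rowP => j; rewrite !mxE /=.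
have [p _ pE] := @cos_raked R (j %/ 2); have [q _ qE] := @sin_raked R (j %/ 2).
by rewrite !pE !qE cst sst.
Qed.

(** Reflection in [m] cancels the part that is odd about [m]. *)
Lemma SM_symmetrize k (i : 'I_(2 * k)) m t :
  SM k (m + t) 0 i + SM k (m - t) 0 i =
  2 * SM k m 0 i * cos ((2 * (i %/ 2) + 1)%:R * t).
Proof.
rewrite !mxE /=; set r := _%:R; case: odd; rewrite mulrBr mulrDr.
  by rewrite sinD sinB; ring.
by rewrite cosD cosB; ring.
Qed.

(** The first two coordinates trace the unit circle, which a chord meets only at its endpoints. *)
Lemma SM_segment k s t u : (0 < k)%N -> segment (SM k s) (SM k t) (SM k u) ->
  (cos u = cos s /\ sin u = sin s) \/ (cos u = cos t /\ sin u = sin t).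
Proof.
move=> k0 [a + aE]; rewrite /= in_itv /= => /andP[a0 a1].
have k2 : (1 < 2 * k)%N by lia.
have := congr1 (fun v : 'rV_(2 * k) => v 0 (Ordinal (ltnW k2))) aE.
have := congr1 (fun v : 'rV_(2 * k) => v 0 (Ordinal k2)) aE.
rewrite !mxE /= !div.divn_small // muln0 add0n !mul1r => su cu.
rewrite -su -cu; have us := cos2Dsin2 s; have ut := cos2Dsin2 t.
(* The left side is 1 minus the squared norm of the point of the chord. *)
have : a * (1 - a) * ((cos s - cos t) ^+ 2 + (sin s - sin t) ^+ 2) = 0.
  have := cos2Dsin2 u; rewrite -su -cu => uu.
  transitivity ((1 - a) * (cos s ^+ 2 + sin s ^+ 2) + a * (cos t ^+ 2 + sin t ^+ 2) -
    (((1 - a) * cos s + a * cos t) ^+ 2 + ((1 - a) * sin s + a * sin t) ^+ 2)).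
    by ring.
  by rewrite us ut uu; ring.
move=> /eqP; rewrite mulf_eq0 paddr_eq0 ?sqr_ge0 // !sqrf_eq0 mulf_eq0.
rewrite !subr_eq0 eq_sym => /orP[/orP[|]/eqP<-|/andP[/eqP-> /eqP->]].
- by left; split; ring.
- by right; split; ring.
- by right; split; ring.
Qed.

(** * Linear functionals along the curve *)

Definition SM_linear k (f : R -> R) : Prop := exists c, forall t, dot c (SM k t) = f t.

Lemma SM_linearD k f g :
  SM_linear k f -> SM_linear k g -> SM_linear k (fun t => f t + g t).
Proof. by move=> [c cE] [d dE]; exists (c + d) => t; rewrite dotDl cE dE. Qed.

Lemma SM_linearZ k a f : SM_linear k f -> SM_linear k (fun t => a * f t).
Proof. by move=> [c cE]; exists (a *: c) => t; rewrite dotZl cE. Qed.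

Lemma SM_linear_eq k f g : f =1 g -> SM_linear k f -> SM_linear k g.
Proof. by move=> fg [c cE]; exists c => t; rewrite cE fg. Qed.

Lemma SM_linear_sum k (I : finType) (f : I -> R -> R) :
  (forall i, SM_linear k (f i)) -> SM_linear k (fun t => \sum_i f i t).
Proof.
move=> /choice[c cE]; exists (\sum_i c i) => t.
rewrite (big_morph (fun c => dot c (SM k t)) (id1 := 0) (op1 := +%R)).
- exact: eq_bigr.
- by move=> x y; exact: dotDl.
- by rewrite /dot big1 // => i _; rewrite mxE mul0r.
Qed.

Lemma SM_linear_cos k m j : (j < k)%N ->
  SM_linear k (fun t => cos ((2 * j + 1)%:R * (t - m))).
Proof.
move=> jk; set n := (2 * j + 1)%N.
have coord i (ik : (i < 2 * k)%N) : SM_linear k (fun t => SM k t 0 (Ordinal ik)).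
  exists (delta_mx 0 (Ordinal ik)) => t; rewrite /dot (bigD1 (Ordinal ik)) //=.
  rewrite mxE !eqxx mul1r big1 ?addr0 // => l /negPf lk.
  by rewrite mxE lk andbF mul0r.
have evk : (2 * j < 2 * k)%N by rewrite ltn_mul2l.
have odk : (n < 2 * k)%N by rewrite /n; lia.
have := SM_linearD (SM_linearZ (cos (n%:R * m)) (coord _ evk))
                   (SM_linearZ (sin (n%:R * m)) (coord _ odk)).
apply: SM_linear_eq => t; rewrite !mxE /=.
have -> : (2 * j %/ 2 = j)%N by rewrite mulKn.
have -> : (n %/ 2 = j)%N by rewrite /n; lia.
have -> : odd (2 * j) = false by lia.
have -> : odd n by rewrite /n; lia.
by rewrite -/n mulrBr cosB mulrC [sin _ * _]mulrC.
Qed.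

(** Induction on [j] by [4 cos^2 u cos x = cos (x + 2 u) + 2 cos x + cos (x - 2 u)]. *)
Lemma SM_linear_cosX k m j i : (i + j < k)%N ->
  SM_linear k (fun t => cos (t - m) ^+ (2 * j) * cos ((2 * i + 1)%:R * (t - m))).
Proof.
elim: j i => [|j IHj] i ijk.
  apply: (SM_linear_eq _ (SM_linear_cos m (_ : (i < k)%N))); last by lia.
  by move=> t; rewrite muln0 expr0 mul1r.
have h1 := IHj i.+1 ltac:(lia); have h0 := IHj i ltac:(lia).
(* For [i = 0] the frequency -1 folds back to 1, which matches [0.-1 = 0]. *)
have hN := IHj i.-1 ltac:(lia).
have := SM_linearZ (1/4) (SM_linearD h1 (SM_linearD (SM_linearZ 2 h0) hN)).
apply: SM_linear_eq => t; move: (t - m) => u; rewrite (mulnS 2 j) exprD.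
have -> : cos ((2 * i.+1 + 1)%:R * u) = cos ((2 * i + 1)%:R * u + (u + u)).
  by congr cos; rewrite mulnS -addnA natrD; ring.
have -> : cos ((2 * i.-1 + 1)%:R * u) = cos ((2 * i + 1)%:R * u - (u + u)).
  case: i {ijk h1 h0 hN} => [|i] /=; first by rewrite -cosN; congr cos; ring.
  by congr cos; rewrite mulnS -addnA natrD; ring.
by rewrite cos_add2; field.
Qed.

Lemma SM_linear_raked k m p : raked k p -> SM_linear k (fun t => p.[cos (t - m)]).
Proof.
move=> hp.
suff /SM_linear_sum : forall i : 'I_(2 * k), SM_linear k (fun t => p`_i * cos (t - m) ^+ i).
  apply: SM_linear_eq => t; exact/esym/(horner_coef_wide _ (raked_size hp)).
move=> i; case: (boolP (odd i)) => oi; last first.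
  by exists 0 => t; rewrite hp ?oi // mul0r /dot big1 // => l _; rewrite mxE mul0r.
apply: SM_linearZ.
have ik : (0 + i %/ 2 < k)%N by have := ltn_ord i; lia.
apply: (SM_linear_eq _ (SM_linear_cosX m ik)) => t.
by rewrite mul1r -exprSr; congr (_ ^+ _); lia.
Qed.


Lemma peak_edge k m h : (0 < k)%N -> 0 < h < pi / 2 -> peak k (cos h) ->
  is_edge (Bsym R k) (segment (SM k (m - h)) (SM k (m + h))).
Proof.
move=> k0 /andP[h0 hpi] [p [b [hp pb ph pu]]].
have [c cE] := SM_linear_raked m hp.
have cosI t : -1 <= cos t <= 1 by rewrite cos_geN1 cos_le1.
have cl : dot c (SM k (m - h)) = b by rewrite cE addrAC subrr add0r cosN.
have cr : dot c (SM k (m + h)) = b by rewrite cE addrAC subrr add0r.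
have sh : 0 < sin h by rewrite sin_gt0_pihalf // h0.
have ch : 0 < cos h.
  by rewrite cos_gt0_pihalf // hpi andbT; have := pi_gt0 R; lra.
have [||||||Bb segE] := @conv_hull_face _ _ (range (SM k)) c b (SM k (m - h)) (SM k (m + h)).
- by move=> _ [t _ <-]; rewrite cE pb.
- by exists (m - h).
- by exists (m + h).
- exact: cl.
- exact: cr.
- move=> _ [t _ <-]; rewrite cE => /(pu _ (cosI _)).
  have [u ->] : exists u, t = m + u by exists (t - m); ring.
  rewrite addrAC subrr add0r => cu.
  (* Equal cosines leave only the angles [h] and [- h], that is, the two endpoints. *)
  have /orP[] : (sin u == sin h) || (sin u == - sin h).
    by rewrite -eqf_sqr !sin2cos2 cu.
  + by move=> /eqP su; right; apply: SM_ext; rewrite ?cosD ?sinD cu su.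
  + move=> /eqP su; left; apply: SM_ext; first by rewrite cosD cosB cu su; ring.
    by rewrite sinD sinB cu su; ring.
split.
  exists c, b; split=> //; split=> //.
    (* With [c = 0] the maximum would be 0, attained at 0 as well as at [cos h]. *)
    apply/eqP => c0; have b0 : b = 0.
      by rewrite -cl c0 /dot big1 // => i _; rewrite mxE mul0r.
    have : 0 = cos h by apply: pu; rewrite ?(raked_horner0 hp) // lerN10 ler01.
    by move/eqP; rewrite lt_eqF.
  by exists (SM k (m + h)); rewrite -segE; exact: segment_right.
(* Coinciding endpoints would force [cos (2 h) = 1], against [0 < sin h]. *)
apply: affine_dim_segment; apply/eqP => SMlr.
have : segment (SM k (m - h)) (SM k (m - h)) (SM k (m + h)).
  by rewrite -SMlr; exact: segment_left.
move=> /(SM_segment k0) ends.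
have [ec es] : cos (m + h) = cos (m - h) /\ sin (m + h) = sin (m - h) by case: ends.
have : cos ((m + h) - (m - h)) = 1 by rewrite cosB ec es -!expr2 cos2Dsin2.
have -> : m + h - (m - h) = h + h by ring.
by rewrite cosD -!expr2 cos2sin2; nra.
Qed.

Lemma edge_peak k m h : (0 < k)%N ->
  is_edge (Bsym R k) (segment (SM k (m - h)) (SM k (m + h))) -> peak k (cos h).
Proof.
move=> k0 [[c [b [[_ cb _] segE]]] _].
have segb t : segment (SM k (m - h)) (SM k (m + h)) (SM k t) <-> dot c (SM k t) = b.
  by rewrite segE; split=> [[]//|ctb]; split=> //; apply: sub_conv_hull; exists t.
have le_b t : dot c (SM k t) <= b by apply: cb; apply: sub_conv_hull; exists t.
have /choice[T TP] (j : nat) : exists p : {poly R},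
    raked j.+1 p /\ forall t, cos ((2 * j + 1)%:R * t) = p.[cos t].
  by have [p hp pE] := @cos_raked R j; exists p.
(* The coefficients come from [SM_symmetrize]. *)
pose p := \sum_(i < 2 * k) (c 0 i * SM k m 0 i) *: T (i %/ 2)%N.
have hp : raked k p.
  apply: raked_sum => i; apply: rakedZ; apply: raked_widen (TP (i %/ 2)%N).1.
  by have := ltn_ord i; lia.
have pE t : 2 * p.[cos t] = dot c (SM k (m + t)) + dot c (SM k (m - t)).
  rewrite horner_sum mulr_sumr -big_split; apply: eq_bigr => i _ /=.
  by rewrite -mulrDr SM_symmetrize hornerZ -(TP _).2; ring.
exists p, b; split=> //.
- move=> y /acosK <-; have := pE (acos y).
  by have := le_b (m + acos y); have := le_b (m - acos y); lra.
- have := pE h; have /segb-> := segment_left (SM k (m - h)) (SM k (m + h)).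
  by have /segb-> := segment_right (SM k (m - h)) (SM k (m + h)); lra.
(* The values at [m + t] and [m - t] are at most [b] with mean [b], so both equal [b]. *)
- move=> y /acosK yE; rewrite -yE; move: (acos y) => t pb.
  have : dot c (SM k (m + t)) = b.
    by have := pE t; have := le_b (m + t); have := le_b (m - t); lra.
  move=> /segb /(SM_segment k0) ends.
  have -> : t = m + t - m by ring.
  case: ends => -[ct st]; rewrite cosB ct st -cosB.
    by rewrite addrAC subrr add0r cosN.
  by rewrite addrAC subrr add0r.
Qed.

(** [m] is the midpoint and [h] half the length of the shorter arc. *)
Lemma arc_midpoint k (alpha beta : R) :
    ~ same_point alpha beta -> ~ antipodal alpha beta ->
  exists m h, [/\ 0 < h < pi / 2, arc_length alpha beta = 2 * h &
    segment (SM k alpha) (SM k beta) = segment (SM k (m - h)) (SM k (m + h))].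
Proof.
move=> nsame nanti; rewrite /arc_length.
have := ccw_length_same_point alpha beta; have := ccw_length_same_point beta alpha.
have /andP[] := ccw_length_bounds alpha beta; have /andP[] := ccw_length_bounds beta alpha.
set d1 := ccw_length alpha beta; set d2 := ccw_length beta alpha => d20 d2pi d10 d1pi.
move=> same2 same1; case: (same2) => l2 E2; case: (same1) => l1 E1.
have d1_gt0 : 0 < d1.
  rewrite lt_neqAle d10 eq_sym andbT; apply/eqP => d1E; apply: nsame.
  by rewrite -[alpha]addr0 -d1E.
have d2_gt0 : 0 < d2.
  rewrite lt_neqAle d20 eq_sym andbT; apply/eqP => d2E; apply: nsame; exists (- l2); rewrite mulrNz mulNr.
  by rewrite {1}E2 d2E; ring.
have d1_neqpi : d1 != pi.
  by apply/eqP => d1E; apply: nanti; rewrite /antipodal -d1E.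
(* The sum is a multiple of [2 * pi] below [4 * pi]. *)
have d12 : d1 + d2 <= 2 * pi.
  have dE : d1 + d2 = (- (l1 + l2))%:~R * (2 * pi).
    by rewrite mulrNz intrD; lra.
  have : (- (l1 + l2) < 2)%R.
    rewrite -(ltr_int R) -(ltr_pM2r (_ : 0 < 2 * pi :> R)) -?dE; first lra.
    by rewrite mulr_gt0 ?pi_gt0.
  move=> lt2; have le1 : - (l1 + l2) <= 1 by lia.
  by rewrite dE ler_piMl ?lerz1 // mulr_ge0 // pi_ge0.
have SM1 : SM k beta = SM k (alpha + d1) by rewrite (SM_same_point k same1).
have SM2 : SM k alpha = SM k (beta + d2) by rewrite (SM_same_point k same2).
case: (leP d1 d2) => d.
- exists (alpha + d1 / 2), (d1 / 2); split; [|by field|].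
    by move: d1_neqpi; rewrite neq_lt => /orP[] ?; lra.
  by rewrite SM1; congr (segment (SM k _) (SM k _)); field.
- exists (beta + d2 / 2), (d2 / 2); split; [|by field|].
    by lra.
  by rewrite segmentC SM2; congr (segment (SM k _) (SM k _)); field.
Qed.

End Edges.

Theorem theorem1p1 (R : realType) (k : nat) (hk : (0 < k)%N) :
  exists psi : R,
    (2 * k%:R - 2) / (2 * k%:R - 1) * pi <= psi < pi /\
    forall alpha beta : R,
      ~ same_point alpha beta -> ~ antipodal alpha beta ->
      (arc_length alpha beta < psi ->
         is_edge (Bsym R k) (segment (SM k alpha) (SM k beta))) /\
      (psi < arc_length alpha beta ->
         ~ is_edge (Bsym R k) (segment (SM k alpha) (SM k beta))).
Proof.
set L : R := _ / _ * pi; have pi0 := pi_gt0 R.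
(* Hence [cos (L / 2)] is the Chebyshev bound [sin (pi / 2 / n)] with [n = 2 k - 1]. *)
have Lhalf : pi / 2 - L / 2 = pi / 2 / (2 * k.-1 + 1)%:R.
  rewrite /L -{1 2}(prednK hk) natrD natrM -natr1; field.
  by rewrite -natrM natr1 pnatr_eq0 /=; lra.
have L0 : 0 <= L.
  have k1 : 1 <= k%:R :> R by rewrite ler1n.
  by rewrite /L mulr_ge0 ?pi_ge0 // divr_ge0 //; lra.
have Lpi : L < pi.
  suff : 0 < pi / 2 - L / 2 by lra.
  by rewrite Lhalf !divr_gt0 // ltr0n addn1.
have [x0 /andP[x00 x01] x0P] := @peak_lower_bound R k.
have cosI (d : R) : 0 < d < pi -> 0 < cos (d / 2) < 1.
  move=> dpi; rewrite cos_gt0_pihalf; last by lra.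
  by rewrite -{2}cos0 ltr_cos ?in_itv /=; lra.
(* Including [L] gives the lower bound on [sup S] and keeps [S] nonempty: for [k = 1] the body is a
   disc, without edges. *)
pose S : set R := [set d | d = L \/ 0 < d < pi /\ peak k (cos (d / 2))]%classic.
have S_le : ubound S (Num.max L (2 * acos x0)).
  move=> d [->|[dpi pkd]]; rewrite le_max ?lexx //; apply/orP; right.
  have x0d := x0P _ (cosI _ dpi) pkd.
  have x0I : -1 <= x0 <= 1 by lra.
  rewrite mulrC -ler_pdivrMr // leNgt; apply/negP => /[dup] hd.
  rewrite -ltr_cos ?in_itv /= ?acos_ge0 ?acos_lepi //; last by lra.
  by rewrite acosK // ltNge x0d.
have SL : S L by left.
have Sub : has_ubound S by exists (Num.max L (2 * acos x0)).
exists (sup S); split.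
  rewrite ub_le_sup //=.
  apply: le_lt_trans (ge_sup (ex_intro _ L SL) S_le) _.
  rewrite gt_max Lpi mulrC -ltr_pdivlMr //=; have x0I : -1 <= x0 <= 1 by lra.
  rewrite -ltr_cos ?in_itv /= ?acos_ge0 ?acos_lepi //; last by lra.
  by rewrite cos_pihalf acosK.
move=> alpha beta nsame nanti.
have [m [h [/andP[h0 hpi] -> ->]]] := arc_midpoint k nsame nanti; split.
- move=> /(sup_gt (ex_intro _ L SL))[e Se he]; apply: peak_edge => //; first by rewrite h0.
  have cos_lt (e' : R) : 2 * h < e' -> e' <= pi -> cos (e' / 2) < cos h.
    by move=> he' epi; rewrite ltr_cos ?in_itv /=; lra.
  (* An edge length [e] above [2 * h] is handled by dilation, [e = L] by the Chebyshev
     construction. *)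
  case: Se => [eE|[epi pke]]; last first.
    apply: peak_up pke; first by have /andP[] := cosI _ epi.
    by apply: ltW; apply: cos_lt => //; lra.
  rewrite -(prednK hk); apply: peak_above_chebyshev.
    rewrite -Lhalf -cosBpihalf addrAC subrr add0r cosN -eE.
    by apply: cos_lt => //; lra.
  by rewrite -cos0 ltr_cos ?in_itv /=; lra.
- move=> hS /(edge_peak hk) pk; suff : 2 * h <= sup S by rewrite leNgt hS.
  apply: ub_le_sup => //; right; split; first by lra.
  by rewrite mulrC mulKf.
Qed.
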